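(* Let $(X,\mu)$ be a probability space, let $Y$ be a finite set, let $\nu$ be a probability measure on $Y$ whose support is equal to $Y$, and let $c:X\times Y\to\mathbb{R}$ be measurable. If $\mu$ has no atoms, then for any $\mathcal{W}_\infty$-optimal transport plan $\pi\in\Pi(\mu,\nu)$ there exists a transport map $T:X\to Y$ such that $(\mathrm{Id}\times T)_\#\mu$ has the same $\infty$-transport cost as $\pi$, i.e. $\|c\|_{L^\infty((\mathrm{Id}\times T)_\#\mu)}=\|c\|_{L^\infty(\pi)}$.
   Context: $Y$ carries the $\sigma$-algebra of all its subsets and $X\times Y$ the product $\sigma$-algebra. That the support of $\nu$ equals $Y$ means $\nu(\{y\})>0$ for all $y\in Y$. $\Pi(\mu,\nu)$ is the set of probability measures on $X\times Y$ with left marginal $\mu$ and right marginal $\nu$; its elements are called transport plans. The $\infty$-transport cost of $\pi\in\Pi(\mu,\nu)$ is $\|c\|_{L^\infty(\pi)}\in(-\infty,+\infty]$, understood as the $\pi$-essential supremum of $c$ (not of $|c|$), so $\|c\|_{L^\infty(\pi)}\le\omega$ means $\pi(\{(x,y): c(x,y)>\omega\})=0$. A plan $\pi\in\Pi(\mu,\nu)$ is $\mathcal{W}_\infty$-optimal if $\|c\|_{L^\infty(\pi)}=\inf_{\tilde\pi\in\Pi(\mu,\nu)}\|c\|_{L^\infty(\tilde\pi)}$. A transport map is a measurable $T:X\to Y$ such that $(\mathrm{Id}\times T)_\#\mu$, the push-forward of $\mu$ under $x\mapsto(x,T(x))$, belongs to $\Pi(\mu,\nu)$. An atom of $\mu$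 is a measurable set $E$ with $\mu(E)>0$ such that every measurable $F\subset E$ has $\mu(F)\in\{0,\mu(E)\}$. *)

(* Defs.v *)
From HB Require Import structures.
From mathcomp Require Import all_boot all_order all_algebra.
From mathcomp Require Import all_classical all_reals all_analysis.
From mathcomp Require Import ess_sup_inf.

Set Implicit Arguments.
Unset Strict Implicit.
Unset Printing Implicit Defensive.

Local Open Scope classical_set_scope.
Local Open Scope ring_scope.

Definition is_atom (d : measure_display) (T : measurableType d) (R : realType)
    (mu : {measure set T -> \bar R}) (E : set T) : Prop :=
  [/\ measurable E, (0 < mu E)%E &
      forall F : set T, measurable F -> F `<=` E -> mu F = 0%E \/ mu F = mu E].

Definition atomless (d : measure_display) (T : measurableType d)
    (R : realType) (mu : {measure set T -> \bar R}) : Prop :=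
  forall E : set T, ~ is_atom mu E.

Section transport.
Context (dX dY : measure_display) (X : measurableType dX)
  (Y : measurableType dY) (R : realType).
Implicit Types (mu : probability X R) (nu : probability Y R)
  (pi : probability (X * Y)%type R) (c : X * Y -> R) (T : {mfun X >-> Y}).

(* Library measures are total functions on [set T], meaningful on measurable
   sets only, hence marginals are not compared by equality of functions. *)
Definition transport_plans mu nu : set (probability (X * Y)%type R) :=
  [set pi | (forall A : set X, measurable A -> pushforward pi fst A = mu A) /\
            (forall B : set Y, measurable B -> pushforward pi snd B = nu B)].

(* [ess_sup] is the essential supremum of the function itself, not of its
   absolute value. *)
Definition transport_cost c pi : \bar R := ess_sup pi (EFin \o c).

Definition Winfty_optimal mu nu c pi : Prop :=
  transport_plans mu nu pi /\
  transport_cost c pi =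
    ereal_inf [set transport_cost c pi' | pi' in transport_plans mu nu].

Definition graph_map T (x : X) : X * Y := (x, T x).

Lemma measurable_graph_map T : measurable_fun [set: X] (graph_map T).
Proof. by apply: measurable_fun_pair => //; exact: measurable_funPT. Qed.

HB.instance Definition _ T :=
  isMeasurableFun.Build _ _ _ _ (graph_map T) (measurable_graph_map T).

(* [distribution] is the push-forward, packaged as a probability measure. *)
Definition graph_plan mu T : probability (X * Y)%type R :=
  distribution mu (graph_map T).

Definition is_transport_map mu nu T : Prop :=
  transport_plans mu nu (graph_plan mu T).

End transport.

(* Main.v *)
From HB Require Import structures.
Require Import Defs.
From mathcomp Require Import all_boot all_order all_algebra.
From mathcomp Require Import all_classical all_reals all_analysis.
From mathcomp Require Import measurable_realfun ess_sup_inf lra.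

(* Let omega be the cost of pi and N = {c > omega}, so pi N = 0. An atomless
   finite measure takes every intermediate value on subsets of a given set
   (Sierpinski), so X can be cut into pieces T^-1(y) such that T^-1(y) and
   pi(. x {y}) give the same mass to each cell of the finite partition
   generated by the sections S_y = {x | N (x, y)}. Hence (Id x T)_# mu has
   second marginal nu, and mu(S_y /\ T^-1(y)) = pi(S_y x {y}) = 0 for every y,
   so its cost is at most omega; it is at least omega because pi is optimal. *)

Set Implicit Arguments.
Unset Strict Implicit.
Unset Printing Implicit Defensive.

Import Order.TTheory GRing.Theory Num.Theory.
Import numFieldNormedType.Exports.

Local Open Scope classical_set_scope.
Local Open Scope ring_scope.

Lemma preimage_if (X Y : Type) (S : set X) (f g : X -> Y) (B : set Y) :
  (fun x => if x \in S then f x else g x) @^-1` B =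
    (S `&` f @^-1` B) `|` (g @^-1` B `\` S).
Proof.
apply/seteqP; split=> x /=;
  by have [xS|xS] := pselect (S x); rewrite ?(mem_set xS) ?(memNset xS); tauto.
Qed.

Section atomless_finite_measure.
Context (R : realType) (d : measure_display) (X : measurableType d)
  (mu : {measure set X -> \bar R}).

Hypothesis mu_fin : fin_num_fun mu.

(** Finite masses are read as real numbers, so that differences make sense and [lra] applies. *)
Local Notation m A := (fine (mu A)).

Lemma fine_measureK (A : set X) : measurable A -> (m A)%:E = mu A.
Proof. by move=> mA; rewrite fineK// mu_fin. Qed.

Lemma fine_measure_ge0 (A : set X) : 0 <= m A.
Proof. exact/fine_ge0/measure_ge0. Qed.

Lemma fine_measureDI (A B : set X) : measurable A -> measurable B ->
  m A = m (A `\` B) + m (A `&` B).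
Proof.
move=> mA mB; rewrite (measureDI _ mA mB) fineD// mu_fin//.
  exact: measurableD.
exact: measurableI.
Qed.

Lemma le_fine_measure (A B : set X) : measurable A -> measurable B ->
  A `<=` B -> m A <= m B.
Proof.
move=> mA mB AB; rewrite -lee_fin !fine_measureK//.
by rewrite le_measure// inE.
Qed.

Lemma fine_measure_subD (A B : set X) : measurable A -> measurable B ->
  B `<=` A -> m (A `\` B) = m A - m B.
Proof.
move=> mA mB BA; rewrite (fine_measureDI mA mB).
by rewrite (setIidr BA) addrK.
Qed.

(** * Intermediate values of an atomless measure *)

Hypothesis mu_atomless : atomless mu.

(** As [A] is not an atom, some [F] inside it has mass neither [0] nor [m A]; the lighter of [F] and
    its complement in [A] will do. *)
Lemma atomless_half (A : set X) : measurable A -> 0 < m A ->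
  exists B, [/\ measurable B, B `<=` A, 0 < m B & 2 * m B <= m A].
Proof.
move=> mA A0; apply: contrapT => noB; apply: (mu_atomless (E := A)).
split => //; first by rewrite -(fine_measureK mA).
move=> F mF FA; apply: contrapT => /not_orP[F0 FmA].
have mD : measurable (A `\` F) by exact: measurableD.
have DE := fine_measure_subD mA mF FA.
have D0 : m (A `\` F) != 0.
  apply/eqP => D0; apply: FmA.
  rewrite -(fine_measureK mF) -(fine_measureK mA); congr EFin.
  by move: DE; rewrite D0 => /esym/eqP; rewrite subr_eq0 => /eqP.
have mF0 : m F != 0.
  by apply/eqP => F0'; apply: F0; rewrite -(fine_measureK mF) F0'.
have := fine_measure_ge0 F; have := fine_measure_ge0 (A `\` F).
rewrite !le_eqVlt ![0 == _]eq_sym (negPf mF0) (negPf D0) /= => Dgt0 Fgt0.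
apply: noB; have [FD|DF] := leP (m F) (m (A `\` F)).
  by exists F; split=> //; lra.
by exists (A `\` F); split=> //; lra.
Qed.

Lemma atomless_small (A : set X) (e : R) : measurable A -> 0 < m A -> 0 < e ->
  exists B, [/\ measurable B, B `<=` A, 0 < m B & m B < e].
Proof.
move=> mA A0 e0.
have small n : exists B, [/\ measurable B, B `<=` A, 0 < m B &
    n%:R * m B <= m A].
  elim: n => [|n [B [mB BA B0 nB]]].
    by exists A; split => //; rewrite mul0r fine_measure_ge0.
  have [C [mC CB C0 BC]] := atomless_half mB B0.
  exists C; split => //; first exact: subset_trans BA.
  (* Halving turns the factor [n] into [2 * n], which dominates [n + 1] only for positive [n]; hence
     the separate case [n = 0]. *)
  case: n nB => [|n] nB; first by have := le_fine_measure mB mA BA; lra.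
  apply: le_trans nB; apply: le_trans (ler_wpM2l (ler0n _ _) BC).
  rewrite mulrA ler_wpM2r ?fine_measure_ge0// -natr1 -[n.+1%:R]natr1.
  by have := ler0n R n; lra.
have [n An] : exists n : nat, m A / e < n%:R.
  exists (Num.bound (m A / e)); apply: archi_boundP.
  by rewrite divr_ge0 ?fine_measure_ge0// ltW.
have [B [mB BA B0 nB]] := small n; exists B; split => //.
move: An; rewrite ltr_pdivrMr// => An; have := le_lt_trans nB An.
by rewrite ltr_pM2l// -(pmulr_lgt0 _ e0) (lt_trans A0).
Qed.

(** [B] is the union of a greedy increasing sequence. Its masses converge, so the gains tend to
    zero, and each gain is at least half of what was available. *)
Lemma exists_maximal_subset (A : set X) (t : R) : measurable A -> 0 <= t ->
  exists B, [/\ measurable B, B `<=` A, m B <= t &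
    forall C, measurable C -> B `<=` C -> C `<=` A -> m C <= t -> m C <= m B].
Proof.
move=> mA t0.
pose F B := [/\ measurable B, B `<=` A & m B <= t].
(* Greedy step: gain at least half of what can still be gained. *)
have /choice[h hP] B : exists B', F B -> [/\ F B', B `<=` B' &
    forall C, F C -> B `<=` C -> m C - m B <= 2 * (m B' - m B)].
  have [FB|nFB] := pselect (F B); last by exists B => /nFB.
  pose S := [set m C | C in [set C | F C /\ B `<=` C]].
  have SB : S (m B) by exists B => //; split.
  have supS : has_sup S.
    by split; [exists (m B)|exists t => _ [C [[_ _ ?] _] <-]].
  have leS C : F C -> B `<=` C -> m C <= sup S.
    by move=> FC BC; apply: sup_upper_bound => //; exists C.
  (* If nothing can be gained, [B] is kept; otherwise the gap is positive, as [sup_adherent]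
     requires. *)
  have [supB|Bsup] := leP (sup S) (m B).
    exists B => _; split => // C FC BC.
    by have := leS _ FC BC; lra.
  have e0 : 0 < (sup S - m B) / 2 by lra.
  have [_ [B' [FB' BB'] <-] B'sup] := sup_adherent e0 supS.
  by exists B' => _; split => // C FC BC; have := leS _ FC BC; lra.
pose u n := iter n h set0.
have Fu n : F (u n).
  elim: n => [|n IH] /=; last by have [] := hP _ IH.
  by split => //; rewrite measure0.
have mu_ n : measurable (u n) by have [] := Fu n.
have ndu : nondecreasing_seq u.
  by apply/nondecreasing_seqP => n; apply/subsetPset; have [] := hP _ (Fu n).
have mU : measurable (\bigcup_n u n) by exact: bigcup_measurable.
have cvu : (fun n => m (u n)) @ \oo --> m (\bigcup_n u n).
  apply: fine_cvg; rewrite fine_measureK//.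
  exact: nondecreasing_cvg_mu.
exists (\bigcup_n u n); split => //.
- by apply: bigcup_sub => n _; have [] := Fu n.
- by apply: (cvgr_to_le cvu); apply: nearW => n; have [] := Fu n.
move=> C mC UC CA Ct.
have cvuS : (fun n => m (u n.+1)) @ \oo --> m (\bigcup_n u n).
  by move: cvu; rewrite -cvg_shiftS.
(* The greedy bound at stage [n] rearranges to [m C <= 2 * m (u n.+1) - m (u n)], whose right side
   tends to the mass of the union. *)
have cvg2 : (fun n => 2 * m (u n.+1) - m (u n)) @ \oo -->
    2 * m (\bigcup_n u n) - m (\bigcup_n u n).
  by apply: cvgB => //; exact: cvgMl_tmp.
suff : m C <= 2 * m (\bigcup_n u n) - m (\bigcup_n u n) by lra.
apply: (cvgr_to_ge cvg2); apply: nearW => n.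
have [_ _ /(_ C)] := hP _ (Fu n).
have unC : u n `<=` C by apply: subset_trans UC; exact: bigcup_sup.
by move=> /(_ _ unC) H; have := H (And3 mC CA Ct) => /=; lra.
Qed.

(** If a maximal [B] had mass below [t], a piece of the rest of [A] with positive mass less than
    [t - m B] could be added to it. *)
Lemma atomless_intermediate (A : set X) (t : R) : measurable A ->
  0 <= t <= m A -> exists B, [/\ measurable B, B `<=` A & m B = t].
Proof.
move=> mA /andP[t0 tA].
have [B [mB BA Bt Bmax]] := exists_maximal_subset mA t0.
exists B; split => //; apply/eqP; rewrite eq_le Bt leNgt /=; apply/negP => ltBt.
have mAB : measurable (A `\` B) by exact: measurableD.
have AB0 : 0 < m (A `\` B) by rewrite fine_measure_subD//; lra.
have tB0 : 0 < t - m B by lra.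
have [C [mC CAB C0 CtB]] := atomless_small mAB AB0 tB0.
have BC0 : C `&` B = set0 by rewrite -subset0 => x [/CAB[_ +] ?]; exact.
have mCB : measurable (C `|` B) by exact: measurableU.
have CBE : m (C `|` B) = m C + m B.
  by rewrite measureU// fineD// mu_fin.
have CBA : C `|` B `<=` A by move=> x [/CAB[]//|/BA].
have := Bmax _ mCB (@subsetUr _ _ _) CBA.
by rewrite CBE => H; have := H ltac:(lra); lra.
Qed.

(** Pieces of mass [w y] are cut off [E] one after the other. What remains at the end is null and is
    sent to [y0]. *)
Lemma atomless_partition (Y : eqType) (y0 : Y) (w : Y -> R) (s : seq Y)
    (E : set X) : uniq s -> (forall y, 0 <= w y) -> measurable E ->
    \sum_(y <- s) w y = m E ->
  exists f : X -> Y, forall y, measurable (f @^-1` [set y]) /\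
    m (E `&` f @^-1` [set y]) = if y \in s then w y else 0.
Proof.
move=> + w0; elim: s E => [|y s IH] E /=.
  move=> _ mE; rewrite big_nil => E0; exists (cst y0) => y.
  have mp : measurable (cst y0 @^-1` [set y] : set X).
    by rewrite preimage_cst; case: ifP.
  split => //; apply/eqP; rewrite eq_le fine_measure_ge0 E0 andbT.
  by apply: le_fine_measure => //; exact: measurableI.
move=> /andP[ys us] mE; rewrite big_cons => wE.
have wyE : 0 <= w y <= m E.
  by rewrite w0 -wE lerDl sumr_ge0.
have [B [mB BE mBw]] := atomless_intermediate mE wyE.
have mEB : measurable (E `\` B) by exact: measurableD.
have [|f fP] := IH _ us mEB.
  by rewrite fine_measure_subD// mBw -wE addrAC subrr add0r.
exists (fun x => if x \in B then y else f x) => z.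
have [mf fE] := fP z.
have mc : measurable (cst y @^-1` [set z] : set X).
  by rewrite preimage_cst; case: ifP.
have mp : measurable ((fun x => if x \in B then y else f x) @^-1` [set z]).
  rewrite (preimage_if B (cst y)); apply: measurableU; first exact: measurableI.
  exact: measurableD.
split => //; rewrite (fine_measureDI (measurableI _ _ mE mp) mB).
rewrite (preimage_if B (cst y)) in_cons.
rewrite (_ : (E `&` _) `\` B = (E `\` B) `&` f @^-1` [set z]); last first.
  apply/seteqP; split=> x /=; first by tauto.
  by move=> [[Ex Bx] <-]; tauto.
rewrite (_ : _ `&` B = B `&` cst y @^-1` [set z]); last first.
  apply/seteqP; split=> x /=; first by tauto.
  by move=> [Bx yz]; split => //; split; [exact: BE|left].
(* Since [y] does not recur in [s], [f] takes the value [y] only on a null part of what is left of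
   [E]. *)
rewrite fE preimage_cst; have [->|zy] := eqVneq z y.
  by rewrite (negbTE ys) add0r mem_set//= setIT.
by rewrite memNset ?setI0 ?measure0 ?addr0//= => yz; rewrite yz eqxx in zy.
Qed.

(* [w y A] plays the role of pi(A x {y}). Induction on [l], treating [E] inside
   and outside [S i] separately, avoids naming the cells of the partition. *)
Lemma atomless_partition_refine (Y I : eqType) (y0 : Y) (w : Y -> set X -> R)
    (s : seq Y) (S : I -> set X) (l : seq I) (E : set X) : uniq s ->
    (forall y A, 0 <= w y A) ->
    (forall y A B, measurable A -> measurable B ->
      w y A = w y (A `\` B) + w y (A `&` B)) ->
    (forall y, y \in s) ->
    (forall A, measurable A -> \sum_(y <- s) w y A = m A) ->
    (forall i, measurable (S i)) -> measurable E ->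
  exists f : X -> Y, (forall y, measurable (f @^-1` [set y])) /\
    forall y, m (E `&` f @^-1` [set y]) = w y E /\
      forall i, i \in l ->
        m (E `&` S i `&` f @^-1` [set y]) = w y (E `&` S i).
Proof.
move=> us w0 wDI sT wm mS; elim: l E => [|i l IH] E mE.
  have [f fP] := atomless_partition y0 us (w0 ^~ E) mE (wm _ mE).
  by exists f; split=> y; have [mf +] := fP y => //; rewrite sT.
have [f [mf fP]] := IH _ (measurableI _ _ mE (mS i)).
have [g [mg gP]] := IH _ (measurableD mE (mS i)).
pose h x := if x \in S i then f x else g x.
have hE y := preimage_if (S i) f g [set y].
have mh y : measurable (h @^-1` [set y]).
  rewrite /h hE; apply: measurableU; first exact: measurableI.
  exact: measurableD.
have split_m F y : measurable F -> m (F `&` h @^-1` [set y]) =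
    m ((F `\` S i) `&` g @^-1` [set y]) + m (F `&` S i `&` f @^-1` [set y]).
  move=> mF; rewrite (fine_measureDI (measurableI _ _ mF (mh y)) (mS i)).
  by congr (m _ + m _); rewrite /h hE; apply/seteqP; split => x /=; tauto.
exists h; split => // y; have [fE fS] := fP y; have [gE gS] := gP y; split.
  by rewrite split_m// gE fE -wDI.
have mEi j : measurable (E `&` S j) by exact: measurableI.
move=> j; rewrite inE => /orP[/eqP->|jl]; rewrite split_m//.
  have -> : (E `&` S i) `\` S i = set0 by rewrite setD_eq0; exact: subIsetr.
  by rewrite -(setIA E (S i)) setIid fE set0I measure0 add0r.
(* [S i] cuts this set in two; [g] controls the outer part, [f] the inner one, and [wDI] adds them
   up. *)
have ED : (E `&` S j) `\` S i = (E `\` S i) `&` S j.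
  by apply/seteqP; split => x /=; tauto.
by rewrite (wDI _ _ (S i))// ED (setIAC E (S j)) gS// fS.
Qed.

End atomless_finite_measure.

(** * Construction of the transport map *)

Lemma measure_fibers (R : realType) (d : measure_display)
    (X : measurableType d) (mu : {measure set X -> \bar R}) (Y : choiceType)
    (s : seq Y) (f : X -> Y) (A : set X) : uniq s -> (forall y, y \in s) ->
    (forall y, measurable (f @^-1` [set y])) -> measurable A ->
  mu A = (\sum_(y <- s) mu (A `&` f @^-1` [set y]))%E.
Proof.
move=> us sT mf mA; rewrite fsbig_seq//.
have mAf y : measurable (A `&` f @^-1` [set y]) by exact: measurableI.
have AE : A = \bigcup_(y in [set` s]) (A `&` f @^-1` [set y]).
  by apply/seteqP; split=> [x Ax|x [y _ []]//]; exists (f x) => //=.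
rewrite -content_fin_bigcup -?AE//.
by move=> y z _ _ [x [[_ /= <-] [_ /= <-]]].
Qed.

Theorem corollary1p6 (R : realType) (dX dY : measure_display)
    (X : measurableType dX) (mu : probability X R)
    (Y : measurableType dY) (finY : finite_set [set: Y])
    (discreteY : forall B : set Y, measurable B)
    (nu : probability Y R) (supp_nu : forall y : Y, (0 < nu [set y])%E)
    (c : X * Y -> R) (mc : measurable_fun [set: X * Y] c)
    (mu_atomless : atomless mu)
    (pi : probability (X * Y)%type R) (pi_opt : Winfty_optimal mu nu c pi) :
  exists T : {mfun X >-> Y},
    is_transport_map mu nu T /\
    transport_cost c (graph_plan mu T) = transport_cost c pi.
Proof.
have [[pi_fst pi_snd] pi_inf] := pi_opt.
have /finite_seqP[s0 s0E] := finY.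
pose s := undup s0.
have us : uniq s by exact: undup_uniq.
have sT y : y \in s.
  by rewrite mem_undup; have : [set: Y] y by []; rewrite s0E.
pose N := (EFin \o c) @^-1` `]transport_cost c pi, +oo[%classic.
have mEc : measurable_fun [set: X * Y] (EFin \o c) by exact/measurable_EFinP.
have mN : measurable N.
  by rewrite -[N]setTI; apply: mEc => //; exact: emeasurable_itv.
have piN : pi N = 0%E by apply/(ae_le_measureP pi _ mEc)/ess_sup_ge.
have mfst (A : set X) : measurable A -> measurable (fst @^-1` A : set (X * Y)).
  by move=> mA; rewrite -[_ @^-1` _]setTI; exact: measurable_fst.
have msnd (y : Y) : measurable (snd @^-1` [set y] : set (X * Y)).
  by rewrite -[_ @^-1` _]setTI; exact: measurable_snd.
have mu_fin : fin_num_fun mu by exact: fin_num_measure.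
have pi_fin : fin_num_fun pi by exact: fin_num_measure.
pose w y A := fine (pi (fst @^-1` A `&` snd @^-1` [set y])).
have w0 y A : 0 <= w y A by exact: fine_measure_ge0.
have wDI y A B : measurable A -> measurable B ->
    w y A = w y (A `\` B) + w y (A `&` B).
  move=> mA mB; rewrite /w (fine_measureDI pi_fin _ (mfst _ mB)); last first.
    by apply: measurableI; [exact: mfst|exact: msnd].
  by congr (fine (pi _) + fine (pi _)); apply/seteqP; split=> x /=; tauto.
have wm A : measurable A -> \sum_(y <- s) w y A = fine (mu A).
  move=> mA; rewrite -pi_fst// /pushforward.
  rewrite (measure_fibers pi us sT msnd (mfst _ mA)) -sum_fine// => y _.
  by rewrite pi_fin//; apply: measurableI; [exact: mfst|exact: msnd].
have mS y : measurable (ysection N y) by exact: measurable_ysection.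
(* The sets to respect are the sections of [N], indexed by [Y] itself, so [s] is both the list of
   values and the list of indices. *)
have [f [mf fP]] := atomless_partition_refine mu_fin mu_atomless point s us w0
  wDI sT wm mS measurableT.
have mfT : measurable_fun [set: X] f.
  move=> _ B mB; rewrite setTI.
  rewrite (_ : f @^-1` B = \bigcup_(y in B) f @^-1` [set y]).
    by apply: fin_bigcup_measurable => //; exact: sub_finite_set finY.
  by apply/seteqP; split=> [x Bx|x [y By /= fxy]];
    [exists (f x)|rewrite /= fxy].
pose T : {mfun X >-> Y} := HB.pack f (isMeasurableFun.Build _ _ _ _ f mfT).
have TP : is_transport_map mu nu T.
  (* The first marginal holds by computation: [fst] after the graph map is the identity. *)
  split=> [//|B mB].
  change (mu (f @^-1` B) = nu B).
  have mfB : measurable (f @^-1` B).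
    by rewrite -[_ @^-1` _]setTI; exact: (mfT measurableT).
  rewrite (measure_fibers mu us sT mf mfB).
  rewrite (measure_fibers (f := id) nu us sT (fun y => discreteY _) mB).
  apply: eq_bigr => y _; have [By|By] := pselect (B y); last first.
    have -> : f @^-1` B `&` f @^-1` [set y] = set0.
      by rewrite -subset0 => x /= [+ fxy]; rewrite fxy.
    have -> : B `&` id @^-1` [set y] = set0.
      by rewrite -subset0 => x /= [+ xy]; rewrite xy.
    by rewrite !measure0.
  have -> : f @^-1` B `&` f @^-1` [set y] = [set: X] `&` f @^-1` [set y].
    by apply/seteqP; split => x /= [+ fxy]; rewrite fxy.
  have -> : B `&` id @^-1` [set y] = [set y].
    by apply/seteqP; split => x /=; [case|move=> ->].
  (* The fiber of [f] over [y] has the mass that [pi] gives to the whole slice at [y], which is the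
     second marginal at [y]. *)
  rewrite setTI; apply: etrans (pi_snd _ (discreteY [set y])).
  rewrite /pushforward.
  rewrite -(fine_measureK mu_fin (mf y)) -(fine_measureK pi_fin (msnd y)).
  by congr EFin; have [+ _] := fP y; rewrite /w preimage_setT !setTI.
exists T; split => //; apply/eqP; rewrite eq_le; apply/andP; split; last first.
  by rewrite pi_inf; apply: ereal_inf_lbound; exists (graph_plan mu T).
apply/ess_supP/(ae_le_measureP _ _ mEc).
change (mu (graph_map T @^-1` N) = 0%E).
have mgN : measurable (graph_map T @^-1` N).
  by rewrite -[_ @^-1` _]setTI; exact: measurable_graph_map.
rewrite (measure_fibers mu us sT mf mgN) big1// => y _.
(* Over the fiber of [y], the graph meets [N] exactly above the section of [N] at [y]. The mass
   there is that of a slice of [N] under [pi], hence zero. *)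
have -> : graph_map T @^-1` N `&` f @^-1` [set y] =
    [set: X] `&` ysection N y `&` f @^-1` [set y].
  by rewrite setTI /graph_map; apply/seteqP; split=> x /= [+ fxy];
    rewrite /ysection /= inE fxy.
have mNf : measurable ([set: X] `&` ysection N y `&` f @^-1` [set y]).
  by rewrite setTI; exact: measurableI.
rewrite -(fine_measureK mu_fin mNf) (fP y).2//.
rewrite /w (subset_measure0 _ mN _ piN)//.
  by apply: measurableI => //; apply: mfst; rewrite setTI.
by move=> [x z] /=; rewrite /ysection /= inE => -[[_ Nxy] ->].
Qed.
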